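(* Let $a \ge 2$ be an integer. There exists a nonempty finite set of arithmetic progressions $$(a^2-1)\mathbb{N} + v_1,\ (a^2-1)\mathbb{N}+v_2,\ \ldots,\ (a^2-1)\mathbb{N}+v_\ell$$ such that: (i) $0 < v_i < a^2-1$ for all $i$; (ii) if $a$ participates for $\beta$, then $\beta \in (a^2-1)\mathbb{N}+v_i$ for some $i$; and (iii) for each $i$ and each sufficiently large $\beta \in (a^2-1)\mathbb{N} + v_i$, $a$ participates for $\beta$.
   Context: A base-$\beta$ representation ($\beta \ge 2$) of a positive integer is canonical if it has no leading zero. A pair of positive integers $a \le b$ is a reversed sum-product pair for the base $\beta$ if the canonical base-$\beta$ representations of $a+b$ and $ab$ are the reverse of each other as digit strings (in particular they have the same number of digits). We say that $a$ participates for the base $\beta$ if there exists an integer $b > \beta$ such that $(a,b)$ is a reversed sum-product pair for the base $\beta$. For integers $q,r$, $q\mathbb{N}+r$ denotes the arithmetic progression $\{qn+r : n = 0,1,2,\ldots\}$. *)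

(* Defs.v *)
From mathcomp Require Import all_boot.

Set Implicit Arguments.
Unset Strict Implicit.
Unset Printing Implicit Defensive.

(* Digit strings are written with the most significant digit first. *)
Definition digits_value (beta : nat) (s : seq nat) : nat :=
  foldl (fun v d => v * beta + d) 0 s.

(* The default value 0 of [head] also excludes the empty string. *)
Definition canonical_repr (beta n : nat) (s : seq nat) : Prop :=
  [/\ all (fun d => d < beta) s, head 0 s != 0 & digits_value beta s = n].

(* For beta >= 2 and n > 0 the canonical representation exists and is unique,
   so the existential below merely names the representation of [a + b]. *)
Definition reversed_sum_product_pair (beta a b : nat) : Prop :=
  [/\ 0 < a, a <= b &
      exists s : seq nat,
        canonical_repr beta (a + b) s /\ canonical_repr beta (a * b) (rev s)].

Definition participates (a beta : nat) : Prop :=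
  exists b : nat, beta < b /\ reversed_sum_product_pair beta a b.

Definition arith_prog (q r m : nat) : Prop := exists n : nat, m = q * n + r.

(* Main.v *)
Require Import Defs.
From mathcomp Require Import all_boot.
From mathcomp Require Import zify.
From Stdlib Require Import Classical.

(* Put N = a + b with digits d_0, .., d_(L-1), least significant first.  The pair
   is reversed iff a N - a^2 is the reversal of N, i.e. iff there are carries c_i
   with c_L = 0 and
     a d_i + c_i = d_(L-1-i) + beta c_(i+1)      (minus a^2 in column 0).
   Elimination between columns i and L-1-i gives
     (a^2 - 1) d_i = beta (a c_(i+1) + c_(L-i)) + (terms independent of beta).
   The condition b > beta forces a d_(L-1) <= d_0, and then 0 <= c_i <= a - 1, so
   the slope lies in [0, a^2 - 1].  Hence, with the carries kept fixed, the digits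
   stay valid when beta is replaced by beta + a^2 - 1: participation is inherited
   along each residue class mod a^2 - 1, upwards from any base where it holds.
   The residue 0 would force a c_(L-1) = 1 mod a^2 - 1, which is impossible. *)

(** * Base-[beta] digit sums *)

Lemma digits_valueE beta s :
  digits_value beta s = \sum_(i < size s) nth 0 (rev s) i * beta ^ i.
Proof.
elim/last_ind: s => [|s x IH]; first by rewrite big_ord0.
rewrite /digits_value foldl_rcons -/(digits_value beta s) IH size_rcons.
rewrite big_ord_recl rev_rcons /= expn0 muln1 addnC big_distrl /=.
by congr (_ + _); apply: eq_bigr => i _; rewrite expnSr mulnA.
Qed.

Lemma digit_sum_lt beta n (d : nat -> nat) :
  (forall i, i < n -> d i < beta) -> \sum_(i < n) d i * beta ^ i < beta ^ n.
Proof.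
elim: n => [|n IH] d_lt; first by rewrite big_ord0.
rewrite big_ord_recr /= expnS.
have ltS := IH (fun i lt_in => d_lt i (ltnW lt_in)).
have := leq_mul (d_lt n (ltnSn n)) (leqnn (beta ^ n)).
by apply: leq_trans; rewrite mulSn ltn_add2r.
Qed.

Lemma digit_sum_split beta m n (d : nat -> nat) : m <= n ->
  exists M, \sum_(i < n) d i * beta ^ i
            = \sum_(i < m) d i * beta ^ i + M * beta ^ m.
Proof.
move=> le_mn; rewrite -(subnKC le_mn); elim: (n - m) => [|k [M IH]].
  by exists 0; rewrite addn0 mul0n addn0.
exists (M + d (m + k) * beta ^ k).
by rewrite addnS big_ord_recr /= IH expnD mulnDl -addnA [beta ^ m * _]mulnC mulnA.
Qed.

(** * Comparison of the end digits *)

(* Here [a + b] has digits [d, 0, .., 0, x, d0] and [a * b] is its reversal, with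
   [Q = beta ^ (L - 2)] for [L >= 3] digits. *)
Lemma no_carry_into_top_digit a b beta Q d0 d x :
    2 <= a -> 2 <= beta -> a <= b -> beta <= Q -> 0 < d -> 0 < d0 ->
    d < beta -> d0 < beta -> x <= 1 -> (a < beta -> x = 0) ->
    a + b = d * (beta * Q) + (x * beta + d0) ->
    a * b = d0 * (beta * Q) + x * Q + d ->
    a * b < beta * (beta * Q) ->
  a * d <= d0.
Proof.
move=> a2 beta2 le_ab le_beta d_gt0 d0_gt0 lt_d lt_d0 le_x x0 sumE prodE lt_prod.
rewrite leqNgt; apply/negP => lt_d0ad.
have [P PE] : exists P, P = beta * Q by exists (beta * Q).
rewrite -PE in sumE prodE lt_prod.
have leP : beta * beta <= P by rewrite PE leq_mul2l le_beta orbT.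
have leQP : 2 * Q <= P by rewrite PE leq_mul2r beta2 orbT.
have eqE : a * (d * P) + a * (x * beta + d0) = a * a + (d0 * P + x * Q + d).
  by rewrite -prodE; nia.
have leSP : d0.+1 * P <= a * (d * P) by rewrite mulnA leq_mul2r lt_d0ad orbT.
rewrite mulSn in leSP.
have lt_b : b < d * P.
  rewrite -(@ltn_pmul2l a) ?(ltnW a2) // prodE.
  have leQ : x * Q <= 1 * Q by rewrite leq_mul2r le_x orbT.
  by lia.
(* For [a < beta], [P >= beta ^ 2] exceeds [a ^ 2 + d]; otherwise the bound on [a * b] gives
   [b < P], hence [d = 1]. *)
case: (ltnP a beta) => [/[dup] lt_a /x0 x_eq0 | le_beta_a].
  rewrite x_eq0 in eqE.
  have le1 : a.+1 * a <= beta * a by rewrite leq_mul2r lt_a orbT.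
  have le2 : beta * a.+1 <= beta * beta by rewrite leq_mul2l lt_a orbT.
  by lia.
have lt_bP : b < P.
  rewrite -(@ltn_pmul2l a) ?(ltnW a2) //; apply: leq_trans lt_prod _.
  by rewrite leq_mul2r le_beta_a orbT.
have d1 : d = 1.
  case: d d_gt0 sumE {eqE prodE leSP lt_b lt_d lt_d0ad} => [|[|d]] // _ sumE.
  by rewrite !mulSn in sumE; lia.
rewrite d1 in sumE eqE lt_b.
(* Now [eqE] factors, over the integers, as [(a - d0) * (P - a) + x * (a * beta - Q) = 1]. *)
have [e eE] : exists e, a = d0 + e.+1 by exists (a - d0).-1; lia.
have [p pE] : exists p, P = a + p.+1 by exists (P - a).-1; lia.
have le2b : 2 * beta <= beta * beta by rewrite leq_mul2r beta2 orbT.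
have [x_eq0|x_eq1] : x = 0 \/ x = 1 by lia.
  rewrite x_eq0 in eqE.
  have /eqP : e.+1 * p.+1 = 1 by nia.
  by rewrite muln_eq1 => /andP[/eqP e1 /eqP p1]; lia.
rewrite x_eq1 in eqE.
have ep : e.+1 * p.+1 + a * beta = 1 + Q by nia.
have le_p : p.+1 <= e.+1 * p.+1 by rewrite leq_pmull.
have le2a : a * 2 <= a * beta by rewrite leq_mul2l beta2 orbT.
by lia.
Qed.

Lemma digit_sum_small beta B n (d : nat -> nat) k :
  0 < beta -> \sum_(i < n) d i * beta ^ i < B * beta ^ k -> k < n -> d k < B.
Proof.
move=> beta_gt0 lt_sum lt_kn; rewrite -(@ltn_pmul2r (beta ^ k)) ?expn_gt0 ?beta_gt0 //.
by apply: leq_ltn_trans lt_sum; rewrite (bigD1 (Ordinal lt_kn)) //= leq_addr.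
Qed.

(** The inequality yields [d 0 >= a], which later rules out negative carries. *)
Lemma reversed_top_digit a beta b L (d : nat -> nat) :
    2 <= a -> 2 <= beta -> a <= b -> beta < b ->
    (forall i, i < L -> d i < beta) -> 0 < d 0 -> 0 < d L.-1 ->
    a + b = \sum_(i < L) d i * beta ^ i ->
    a * b = \sum_(i < L) d (L.-1 - i) * beta ^ i ->
  1 < L /\ a * d L.-1 <= d 0.
Proof.
move=> a2 beta2 le_ab lt_b d_lt d0_gt0 dL_gt0 sumE prodE.
have beta_gt0 : 0 < beta by lia.
have lt_prod : a * b < beta ^ L.
  rewrite prodE; apply: (@digit_sum_lt _ _ (fun i => d (L.-1 - i))) => i lt_i.
  by apply: d_lt; lia.
case: L d_lt dL_gt0 sumE prodE lt_prod => [|[|[|m]]] /= d_lt dL_gt0 sumE prodE lt_prod.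
- by rewrite big_ord0 in sumE; lia.
- by rewrite big_ord1 /= expn0 in sumE; have := d_lt 0 isT; lia.
- split=> //; rewrite leqNgt; apply/negP => lt_d0.
  rewrite !big_ord_recr !big_ord0 /= !expn1 !expn0 in sumE prodE.
  have d1_lt := d_lt 1 isT.
  rewrite add0n subn0 subnn !muln1 in sumE prodE.
  have le1 : (d 0).+1 * beta <= a * d 1 * beta by rewrite leq_mul2r lt_d0 orbT.
  have lt_bd : b < d 1 * beta.
    by rewrite -(@ltn_pmul2l a) ?(ltnW a2) // prodE; lia.
  have lt_ab : a < beta.
    rewrite ltnNge; apply/negP => le_ba.
    move: lt_prod; rewrite ltnNge -mulnn => /negP; apply.
    by rewrite leq_mul // ltnW.
  (* From [beta < b < d 1 * beta]. Two copies of [a * beta] are then available: one exceeds [a * a],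
     the other [d 0 * beta]. *)
  have d1_gt1 : 1 < d 1.
    case: (d 1) lt_bd {d1_lt lt_d0 le1 sumE prodE dL_gt0} => [|[|k]] //; lia.
  have d0_lt_a : d 0 < a by lia.
  have : a * (d 0 + d 1 * beta) = a * a + (d 1 + d 0 * beta) by rewrite -sumE -prodE; lia.
  have [k kE] : exists k, d 1 = k.+2 by exists (d 1 - 2); lia.
  have [e eE] : exists e, a = (d 0 + e).+1 by exists (a - d 0).-1; lia.
  move: d1_lt; rewrite kE => d1_lt.
  have le3 : a.+1 * a <= beta * a by rewrite leq_mul2r lt_ab orbT.
  have le4 : (d 0).+1 * beta <= a * beta by rewrite leq_mul2r d0_lt_a orbT.
  have le6 : k * 1 <= k * a by rewrite leq_mul2l (ltnW a2) orbT.
  have a_d0 : 0 < a * d 0 by rewrite muln_gt0 d0_gt0; lia.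
  by lia.
split=> //.
(* Here [a * b < beta ^ m.+3 <= beta * (a + b) <= 2 * beta * b]. *)
have lt_a2 : a < 2 * beta.
  have b_gt0 : 0 < b by lia.
  rewrite -(@ltn_pmul2r b) //; apply: leq_trans lt_prod _.
  have : beta ^ m.+2 <= a + b.
    rewrite sumE big_ord_recr /= (leq_trans _ (leq_addl _ _)) //.
    by rewrite leq_pmull.
  rewrite -(@leq_pmul2l beta) // -expnS => /leq_trans; apply.
  have : beta * (a + b) <= beta * (2 * b) by rewrite leq_mul2l; apply/orP; right; lia.
  by lia.
rewrite leqNgt; apply/negP => lt_d0.
(* Otherwise [b < d m.+2 * beta ^ m.+2 <= a + b]: the lower digits of [a + b]
   total less than [a], so only the two lowest of them can be nonzero. *)
have top_lt : \sum_(i < m.+2) d i * beta ^ i < a.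
  have [d0L dLL] := (d_lt 0 isT, d_lt m.+2 (ltnSn _)).
  have prod_lt : a * b < (d 0).+1 * beta ^ m.+2.
    rewrite prodE big_ord_recr /= subnn mulSn ltn_add2r.
    apply: (@digit_sum_lt _ _ (fun i => d (m.+2 - i))) => i lt_i.
    by apply: d_lt; lia.
  have : b < d m.+2 * beta ^ m.+2.
    rewrite -(@ltn_pmul2l a) ?(ltnW a2) //; apply: (leq_trans prod_lt).
    by rewrite mulnA leq_mul2r lt_d0 orbT.
  by move: sumE; rewrite big_ord_recr /=; lia.
have d1_le : d 1 <= 1.
  apply: (@digit_sum_small beta 2 m.+2) => //; rewrite expn1.
  by apply: ltn_trans top_lt _.
have d1_0 : a < beta -> d 1 = 0.
  move=> lt_a; apply/eqP; rewrite -leqn0.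
  apply: (@digit_sum_small beta 1 m.+2) => //; rewrite expn1 mul1n.
  exact: ltn_trans lt_a.
have mid i : i < m -> d i.+2 = 0.
  move=> lt_i; apply/eqP; rewrite -leqn0.
  apply: (@digit_sum_small beta 1 m.+2) => //; rewrite mul1n.
  apply: (ltn_trans top_lt); apply: (leq_trans lt_a2).
  rewrite !expnS mulnA (leq_trans _ (leq_pmulr _ _)) ?expn_gt0 ?beta_gt0 //.
  by rewrite leq_mul2r beta2 orbT.
have le_top : a * d m.+2 <= d 0; last by lia.
apply: (@no_carry_into_top_digit a b beta (beta ^ m.+1) _ _ (d 1)) => //.
- by rewrite -{1}(expn1 beta) leq_pexp2l.
- exact: d_lt.
- exact: d_lt.
- rewrite sumE big_ord_recr /= 2!big_ord_recl /= big1 => [|i _]; last first.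
    by rewrite mid.
  rewrite expn0 expn1 !expnS.
  by rewrite muln1 addn0 addnC [d 0 + _]addnC.
- rewrite prodE big_ord_recr big_ord_recr big_ord_recl /= big1; last first.
    move=> i _; have lt_i := ltn_ord i.
    have -> : m.+2 - bump 0 i = (m - i.+1).+2 by rewrite /bump; lia.
    by rewrite mid //; lia.
  have -> : m.+2 - m.+1 = 1 by lia.
  by rewrite subn0 subnn expn0 muln1 addn0 -!expnS addnC [d m.+2 + _]addnC addnA.
Qed.

(** * Equivalence with carry schemes *)

(* The column-by-column computation of [a * N - a ^ 2] for [N = a + b], least
   significant digit first: its digits are those of [N] in reverse order.  The
   subtrahend [a ^ 2] is absorbed entirely in column 0. *)
Definition carry_scheme (a beta L : nat) (d c : nat -> nat) : Prop :=
  [/\ 1 < L, forall i, i < L -> d i < beta, 0 < d 0 & 0 < d L.-1] /\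
  [/\ c 0 = 0, c L = 0, forall i, i <= L -> c i < a
    & forall i, i < L ->
        a * d i + c i = (i == 0) * (a * a) + d (L.-1 - i) + beta * c i.+1].

Lemma participates_carries a beta : 2 <= a -> 2 <= beta -> participates a beta ->
  exists L d c, carry_scheme a beta L d c.
Proof.
move=> a2 beta2 [b [lt_b [a_gt0 le_ab [s [[s_lt s_hd sumE] [_ rs_hd prodE]]]]]].
rewrite digits_valueE in sumE; rewrite digits_valueE size_rev revK in prodE.
have beta_gt0 : 0 < beta by lia.
have s_gt0 : 0 < size s by case: s s_hd {s_lt sumE rs_hd prodE}.
set L := size s in sumE prodE s_gt0; set d := nth 0 (rev s) in sumE.
have d_lt i : i < L -> d i < beta.
  move=> lt_i; apply: (allP s_lt); rewrite -mem_rev; apply: mem_nth.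
  by rewrite size_rev.
have nth_s i : i < L -> nth 0 s i = d (L.-1 - i).
  move=> lt_i; rewrite /d nth_rev -/L; last by lia.
  by congr nth; lia.
have d0_gt0 : 0 < d 0 by rewrite lt0n /d nth0.
have dL_gt0 : 0 < d L.-1.
  by rewrite lt0n -[L.-1]subn0 -nth_s // nth0.
have {}prodE : a * b = \sum_(i < L) d (L.-1 - i) * beta ^ i.
  by rewrite -prodE; apply: eq_bigr => i _; rewrite nth_s.
have [L_gt1 le_d0] := reversed_top_digit _ _ _ _ _
  a2 beta2 le_ab lt_b d_lt d0_gt0 dL_gt0 (esym sumE) prodE.
pose N i := \sum_(k < i) d k * beta ^ k.
pose R i := \sum_(k < i) d (L.-1 - k) * beta ^ k.
have NL : N L = a + b by [].
have RL : R L = a * b by [].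
have le_aN i : 0 < i -> a * a <= a * N i.
  case: i => // i _; rewrite leq_mul2l /N big_ord_recl /= expn0 muln1; nia.
(* Carries are nonnegative: [a * N i - a ^ 2 - R i] is a multiple of [beta ^ i],
   and it exceeds [- beta ^ i] because [N i >= d 0 >= a]. *)
have carryP i : 0 < i <= L ->
    exists2 c, c < a & a * N i = a * a + R i + c * beta ^ i.
  case/andP=> i_gt0 le_i.
  have [M NE] := digit_sum_split beta _ _ d le_i.
  have [M' RE] := digit_sum_split beta _ _ (fun k => d (L.-1 - k)) le_i.
  rewrite -/(N i) -/(N L) NL in NE; rewrite -/(R i) -/(R L) RL in RE.
  have N_lt : N i < beta ^ i by apply: digit_sum_lt => k lt_k; apply: d_lt; lia.
  have R_lt : R i < beta ^ i.
    apply: (@digit_sum_lt _ _ (fun k => d (L.-1 - k))) => k lt_k.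
    by apply: d_lt; lia.
  have eqE : a * N i + a * M * beta ^ i = a * a + R i + M' * beta ^ i.
    have : a * (a + b) = a * a + a * b by rewrite mulnDr.
    by rewrite NE RE mulnDr mulnA addnA => ->.
  have le_M : a * M <= M'.
    rewrite leqNgt; apply/negP => lt_M.
    have leS : M'.+1 * beta ^ i <= a * M * beta ^ i by rewrite leq_mul2r lt_M orbT.
    by have := le_aN i i_gt0; rewrite mulSn in leS; lia.
  have cE : a * N i = a * a + R i + (M' - a * M) * beta ^ i.
    have := mulnDl (M' - a * M) (a * M) (beta ^ i); rewrite subnK //.
    by lia.
  exists (M' - a * M) => //.
  rewrite -(@ltn_pmul2r (beta ^ i)) ?expn_gt0 ?beta_gt0 //.
  apply: leq_ltn_trans (_ : a * N i < _); first by rewrite cE leq_addl.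
  by rewrite ltn_pmul2l.
(* Division recovers the carry of [carryP] as a function of [i], so no choice principle is
   needed. *)
pose c i := if i == 0 then 0 else (a * N i - (a * a + R i)) %/ beta ^ i.
have cP i : 0 < i <= L -> c i < a /\ a * N i = a * a + R i + c i * beta ^ i.
  move=> i_bd; have [k lt_k kE] := carryP i i_bd.
  suff -> : c i = k by [].
  case: i i_bd kE => // i _ kE.
  by rewrite /c /= kE addKn mulnK // expn_gt0 beta_gt0.
have [_ cLE] := cP L (introT andP (conj s_gt0 (leqnn L))).
exists L, d, c; split; split=> //.
(* The last carry vanishes since [a * (a + b)] is exactly [a * a + a * b]. *)
- apply/eqP; move: cLE; rewrite NL RL mulnDr -{1}[_ + _]addn0 => /addnI /esym/eqP.
  by rewrite muln_eq0 expn_eq0 (negbTE (lt0n_neq0 beta_gt0)) orbF.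
- by case=> [|i] le_i; [exact: ltnW | have [] := cP i.+1 le_i].
case=> [|i] lt_i.
  have [_] := cP 1 s_gt0.
  by rewrite /N /R !big_ord1 /= expn0 expn1 !muln1 addn0 mul1n [c 1 * _]mulnC.
have [_ E1] := cP i.+1 (ltnW lt_i).
have [_ E2] := cP i.+2 lt_i.
rewrite /N /R in E1 E2.
rewrite big_ord_recr [in RHS]big_ord_recr /= mulnDr E1 in E2.
rewrite mul0n add0n.
apply/eqP; rewrite -(@eqn_pmul2r (beta ^ i.+1)) ?expn_gt0 ?beta_gt0 //; apply/eqP.
move: E2; rewrite [beta ^ i.+2]expnS.
by move: (beta ^ i.+1) (\sum_(k < _) _) (c _) (c _) => P S x y; lia.
Qed.

Lemma carry_scheme_ends a beta L (d c : nat -> nat) :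
    carry_scheme a beta L d c ->
  a * d 0 = a * a + d L.-1 + beta * c 1 /\ a * d L.-1 + c L.-1 = d 0.
Proof.
case=> [[L_gt1 _ _ _] [c0 cL _ cE]].
have := cE 0 (ltnW L_gt1); have := cE L.-1.
rewrite c0 subnn prednK ?(ltnW L_gt1) // => /(_ (leqnn L)).
rewrite cL subn0; case: eqP => [|_]; first by lia.
by rewrite /= !mul0n mul1n; lia.
Qed.

(** Weighted by powers of [beta], the columns telescope to [a * N = a * a + R], so [b = N - a] has
    [a * b = R]. *)
Lemma carries_participates a beta L (d c : nat -> nat) : 2 <= a ->
  carry_scheme a beta L d c -> participates a beta.
Proof.
move=> a2 scheme; have [E0 EL] := carry_scheme_ends _ _ _ _ _ scheme.
case: scheme => [[L_gt1 d_lt d0_gt0 dL_gt0] [c0 cL c_lt cE]].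
have beta_gt0 : 0 < beta by have := d_lt 0 (ltnW L_gt1); lia.
(* Column 0 gives [a * d 0 > a * a]; with [d 0 + beta <= N] this yields [beta < N - a]. *)
have d0_gt : a < d 0 by rewrite -(@ltn_pmul2l a) ?(ltnW a2) //; lia.
pose N := \sum_(i < L) d i * beta ^ i.
pose R := \sum_(i < L) d (L.-1 - i) * beta ^ i.
have NE : a * N = a * a + R.
  have step i : i < L ->
      a * (\sum_(k < i.+1) d k * beta ^ k)
      = a * a + \sum_(k < i.+1) d (L.-1 - k) * beta ^ k + c i.+1 * beta ^ i.+1.
    elim: i => [|i IH] lt_i.
      by rewrite !big_ord1 /= subn0 expn0 expn1 !muln1 E0 [c 1 * _]mulnC.
    rewrite big_ord_recr [in RHS]big_ord_recr /= mulnDr IH ?(ltnW lt_i) //.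
    have := congr1 (fun x => x * beta ^ i.+1) (cE i.+1 lt_i).
    rewrite /= [beta ^ i.+2]expnS.
    by move: (beta ^ i.+1) (\sum_(k < _) _) => P S; lia.
  have := step L.-1; rewrite prednK ?(ltnW L_gt1) // cL mul0n addn0.
  by apply; apply: leqnn.
have N_ge : a + beta < N.
  rewrite /N; case: L L_gt1 dL_gt0 {d_lt cL c_lt cE EL E0 N R NE} => [|[|L]] // _ /= dL_gt0.
  rewrite big_ord_recl big_ord_recr /= expn0 muln1.
  have le_beta : 1 * beta <= d L.+1 * beta ^ L.+1.
    by rewrite leq_mul // -{1}(expn1 beta) leq_pexp2l.
  by rewrite /bump leq0n add1n; lia.
have d0_lt := d_lt 0 (ltnW L_gt1).
exists (N - a); split; first by lia.
split; [by lia | by lia |].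
pose s := mkseq (fun i => d (L.-1 - i)) L.
have s_rev : rev s = mkseq d L.
  apply: (@eq_from_nth _ 0); rewrite size_rev !size_mkseq // => i lt_i.
  rewrite nth_rev size_mkseq // !nth_mkseq //; last by lia.
  by congr d; lia.
exists s; split; split.
- apply/allP=> x /mapP[i]; rewrite mem_iota => /andP[_ lt_i] ->.
  by apply: d_lt; lia.
- by rewrite -nth0 nth_mkseq ?(ltnW L_gt1) // subn0 -lt0n.
- rewrite digits_valueE s_rev size_mkseq subnKC; last by lia.
  by apply: eq_bigr => i _; rewrite nth_mkseq.
- rewrite s_rev; apply/allP=> x /mapP[i].
  by rewrite mem_iota => /andP[_ lt_i] ->; apply: d_lt.
- by rewrite s_rev -nth0 nth_mkseq ?(ltnW L_gt1) // -lt0n.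
rewrite digits_valueE revK size_rev size_mkseq mulnBr NE addKn.
by apply: eq_bigr => i _; rewrite nth_mkseq.
Qed.

(** * Residue classes of the base modulo [a ^ 2 - 1] *)

(* Adding [a ^ 2 - 1] to the base leaves all carries unchanged: eliminating
   [d (L.-1 - i)] from the two column equations for [i] and [L.-1 - i] shows that
   [(a ^ 2 - 1) * d i] is affine in the base with slope [a * c i.+1 + c (L - i)]. *)
Lemma carry_scheme_step a beta L (d c : nat -> nat) : 2 <= a ->
  carry_scheme a beta L d c ->
  carry_scheme a (beta + (a ^ 2 - 1)) L (fun i => d i + (a * c i.+1 + c (L - i))) c.
Proof.
move=> a2 [[L_gt1 d_lt d0_gt0 dL_gt0] [c0 cL c_lt cE]].
have [q qE] : exists q, a * a = q.+1 by exists (a * a).-1; nia.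
have -> : a ^ 2 - 1 = q by rewrite -mulnn qE subn1.
split; split=> //; try by rewrite addn_gt0 ?d0_gt0 ?dL_gt0.
- move=> i lt_i; have := d_lt i lt_i.
  have := c_lt i.+1 lt_i; have := c_lt (L - i) (leq_subr _ _).
  have : a * (c i.+1).+1 <= a * a -> a * c i.+1 + a <= a * a by rewrite mulnS addnC.
  by move=> H c1 c2 d1; have := H (leq_mul (leqnn a) c2); lia.
move=> i lt_i; have := cE i lt_i.
(* The slopes [s] at [i] and [t] at [L.-1 - i] satisfy [a * s = t + (a ^ 2 - 1) * c i.+1]. *)
have -> : (L.-1 - i).+1 = L - i by lia.
have -> : L - (L.-1 - i) = i.+1 by lia.
have E : a * (a * c i.+1) = q * c i.+1 + c i.+1 by rewrite mulnA qE mulSn addnC.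
by rewrite !mulnDr mulnDl E; lia.
Qed.

Lemma participates_add a beta n : 2 <= a -> 2 <= beta -> participates a beta ->
  participates a (beta + n * (a ^ 2 - 1)).
Proof.
move=> a2 beta2 pa; elim: n => [|n IH]; first by rewrite mul0n addn0.
have beta'2 : 2 <= beta + n * (a ^ 2 - 1) by rewrite (leq_trans beta2) ?leq_addr.
have [L [d [c dc]]] := participates_carries _ _ a2 beta'2 IH.
rewrite mulSn addnCA addnC.
by apply: carries_participates a2 (carry_scheme_step _ _ _ _ _ a2 dc).
Qed.

(** The end columns combine to [(a ^ 2 - 1) * d L.-1 + a * c L.-1 = a ^ 2 + beta * c 1], and
    [a * c L.-1 <= a * (a - 1)]. *)
Lemma participates_not_dvdn a beta : 2 <= a -> 2 <= beta -> participates a beta ->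
  ~~ (a ^ 2 - 1 %| beta).
Proof.
move=> a2 beta2 /(participates_carries _ _ a2 beta2).
case=> L [d [c scheme]]; have [E0 EL] := carry_scheme_ends _ _ _ _ _ scheme.
case: scheme => [_ [_ _ c_lt _]].
apply/negP => /dvdnP[k betaE].
have [q qE] : exists q, a * a = q.+1 by exists (a * a).-1; nia.
move: betaE; rewrite -mulnn qE subn1 /= => betaE.
have E : q * d L.-1 + a * c L.-1 = q + 1 + q * (k * c 1).
  move: E0; rewrite -EL mulnDr mulnA qE mulSn betaE; lia.
have lt_c : a * c L.-1 + a <= q.+1.
  by rewrite addnC -mulnS -qE leq_mul2l c_lt ?leq_pred ?orbT.
have : a * c L.-1 = 1.
  have [x_gt|x_le] := ltnP (d L.-1) (k * c 1).+1.
    have [y yE] : exists y, k * c 1 = d L.-1 + y.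
      by exists (k * c 1 - d L.-1); lia.
    by rewrite yE mulnDr in E; lia.
  have [y yE] : exists y, d L.-1 = (k * c 1).+1 + y.
    by exists (d L.-1 - (k * c 1).+1); lia.
  rewrite yE mulnDr mulnS in E.
  have q_gt2 : 2 < q by rewrite -ltnS -qE; apply: (@leq_mul 2 2).
  by case: y E {yE} => [|y]; rewrite ?mulnS; lia.
by move/eqP; rewrite muln_eq1; lia.
Qed.

(* Two digits with middle carry 1 force beta = a - 1 modulo a^2 - 1; this is
   a - 1 + 3 (a^2 - 1), the first such base that works for every a >= 2. *)
Lemma participates_witness a : 2 <= a -> participates a (3 * a ^ 2 + a - 4).
Proof.
move=> a2.
have [a' aE] : exists a', a = a'.+2 by exists (a - 2); lia.
(* With [d 1 = t] the columns force [d 0 = t * a + 1] and [beta = (t - 1) * a ^ 2 + a - t]; at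
   [a = 2], [t = 3] this has [d 0 = beta]. *)
apply: (@carries_participates _ _ 2
  (fun i => if i == 0 then 4 * a + 1 else 4) (fun i => i == 1)) => //.
split; split=> //.
- by case=> [|[|i]] //= _; rewrite aE -mulnn; nia.
- by rewrite /= addn1.
- by case=> [|[|i]] //= _; lia.
by case=> [|[|i]] //= _; rewrite aE -mulnn; nia.
Qed.

(** Excluded middle decides [P], which will quantify over all bases. *)
Lemma residues_filter (P : nat -> Prop) q :
  exists V : seq nat, forall v, v \in V <-> v < q /\ P v.
Proof.
elim: q => [|q [V VP]]; first by exists [::] => v; split=> // -[].
case: (classic (P q)) => [Pq|nPq].
  exists (q :: V) => v; rewrite inE ltnS leq_eqVlt; split.
    by case/predU1P=> [->|/VP[-> Pv]]; rewrite ?eqxx ?orbT.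
  by case=> /predU1P[->|lt_v] Pv; rewrite ?eqxx //; apply/orP; right; apply/VP.
exists V => v; rewrite ltnS leq_eqVlt; split; first by case/VP=> -> Pv; rewrite orbT.
by case=> /predU1P[-> //|lt_v] Pv; apply/VP.
Qed.

Theorem theorem6p4 (a : nat) (ha : 2 <= a) :
  exists V : seq nat,
    [/\ V <> [::],
        (forall v : nat, v \in V -> 0 < v /\ v < a ^ 2 - 1),
        (forall beta : nat, 2 <= beta -> participates a beta ->
           exists2 v : nat, v \in V & arith_prog (a ^ 2 - 1) v beta)
      & (forall v : nat, v \in V ->
           exists B : nat, forall beta : nat,
             2 <= beta -> B <= beta -> arith_prog (a ^ 2 - 1) v beta ->
             participates a beta)].
Proof.
have q_gt0 : 0 < a ^ 2 - 1 by rewrite -mulnn; nia.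
have [V VP] := residues_filter
  (fun v => exists2 beta, 2 <= beta /\ participates a beta & beta %% (a ^ 2 - 1) = v)
  (a ^ 2 - 1).
have inV beta : 2 <= beta -> participates a beta -> beta %% (a ^ 2 - 1) \in V.
  by move=> beta2 pa; apply/VP; split; [rewrite ltn_pmod | exists beta].
exists V; split.
- have base2 : 2 <= 3 * a ^ 2 + a - 4 by rewrite -mulnn; nia.
  by have := inV _ base2 (participates_witness a ha) => /[swap] ->.
- move=> v /VP[lt_v [beta [beta2 pa] vE]]; split=> //.
  by rewrite lt0n -vE; apply: participates_not_dvdn.
- move=> beta beta2 pa; exists (beta %% (a ^ 2 - 1)); first exact: inV.
  by exists (beta %/ (a ^ 2 - 1)); rewrite mulnC -divn_eq.
(* The threshold is the participating base that put [v] into [V]. *)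
move=> v /VP[lt_v [B [B2 pa] vE]]; exists B => beta _ le_B [n betaE].
have le_n : B %/ (a ^ 2 - 1) <= n.
  by rewrite -ltnS ltn_divLR // (leq_ltn_trans le_B) // betaE mulSn mulnC; lia.
have -> : beta = B + (n - B %/ (a ^ 2 - 1)) * (a ^ 2 - 1).
  rewrite betaE {1}(divn_eq B (a ^ 2 - 1)) vE addnAC -mulnDl subnKC //.
  by rewrite mulnC.
exact: participates_add.
Qed.
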